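(* Let $L,m,r\in\mathbb{Z}_{>0}$, and let $\psi_1,\dots,\psi_r:\mathbb{R}^m\to\mathbb{R}$ be any $r$ linearly independent functions satisfying $\psi_j(\mathbf{0})=0$ for all $j\in\{1,\dots,r\}$. Let $N\in\mathbb{Z}_{>0}$ satisfy $N\geq(r+1)L-1$, and let the sequence $\{u_k\}_{k=0}^{N-1}$, $u_k\in\mathbb{R}^m$, take the form $$u_k=\begin{cases}\lambda_j, & k=jL-1,\\ \mathbf{0}, & \text{otherwise},\end{cases}$$ where $j$ ranges over $\{1,\dots,r\}$ and $\lambda_1,\dots,\lambda_r\in\mathbb{R}^m$. Put $\Psi(w)=\begin{bmatrix}\psi_1(w)&\cdots&\psi_r(w)\end{bmatrix}^\top\in\mathbb{R}^r$ for $w\in\mathbb{R}^m$ and $\hat\Psi_k=\Psi(u_k)$ for $k=0,\dots,N-1$. If $\lambda_1,\dots,\lambda_r$ are such that the $r\times r$ matrix $$\Lambda=\begin{bmatrix}\Psi(\lambda_1)&\Psi(\lambda_2)&\cdots&\Psi(\lambda_r)\end{bmatrix}$$ is invertible, then $\operatorname{rank}(\mathscr{H}_L(\hat\Psi))=rL$.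
   Context: $\mathbb{Z}_{>0}$ is the set of positive integers. Linear independence of the $\psi_j$ means linear independence as real-valued functions on $\mathbb{R}^m$. For a sequence $\{z_k\}_{k=0}^{N-1}$ with $z_k\in\mathbb{R}^\eta$ and $0\le l\le j\le N-1$, write $z_{[l,j]}=\begin{bmatrix} z_l^\top & z_{l+1}^\top & \cdots & z_j^\top\end{bmatrix}^\top$. For $1\le L\le N$, the Hankel matrix of depth $L$ is $\mathscr{H}_L(z)=\begin{bmatrix} z_{[0,L-1]} & z_{[1,L]} & \cdots & z_{[N-L,N-1]}\end{bmatrix}\in\mathbb{R}^{\eta L\times(N-L+1)}$. *)

(* Defs.v *)
From HB Require Import structures.
From mathcomp Require Import all_boot all_order all_algebra.
From mathcomp Require Import reals.

Set Implicit Arguments.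
Unset Strict Implicit.
Unset Printing Implicit Defensive.

Import Order.TTheory GRing.Theory Num.Theory.
Local Open Scope ring_scope.

(* Stated directly because the space of all functions T -> R is not
   finite-dimensional, so that [free] of vector.v does not apply to it. *)
Definition lin_indep_funs (R : realType) (T : Type) (r : nat)
    (psi : 'I_r -> T -> R) : Prop :=
  forall c : 'I_r -> R,
    (forall w : T, \sum_(j < r) c j * psi j w = 0) -> forall j, c j = 0.

Definition mx_of_cols (R : realType) (n p : nat) (v : 'I_p -> 'cV[R]_n) :
    'M[R]_(n, p) :=
  \matrix_(i, j) v j i 0.

(* z_[l, l+L-1]: the vectors z_l, ..., z_(l+L-1) stacked on top of each other.
   The row dimension \sum_(i < L) eta is that of \mxcol and equals eta * L. *)
Definition window (R : realType) (eta L : nat) (z : nat -> 'cV[R]_eta)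
    (l : nat) : 'cV[R]_(\sum_(i < L) eta) :=
  \mxcol_(i < L) z (l + i)%N.

(* Hankel matrix of depth L of z_0, ..., z_(N-1), meant for 1 <= L <= N;
   under that condition no z_k with k >= N occurs in it. *)
Definition hankel (R : realType) (eta N L : nat) (z : nat -> 'cV[R]_eta) :
    'M[R]_(\sum_(i < L) eta, N - L + 1) :=
  mx_of_cols (fun t : 'I_(N - L + 1) => window L z t).

(* Main.v *)
Require Import Defs.
From HB Require Import structures.
From mathcomp Require Import all_boot all_order all_algebra.
From mathcomp Require Import reals zify.

Set Implicit Arguments.
Unset Strict Implicit.
Unset Printing Implicit Defensive.

Import Order.TTheory GRing.Theory Num.Theory.
Local Open Scope ring_scope.

(** A pulse train spaced by the window length.  The input is zero except at the
times L - 1, 2L - 1, ..., rL - 1, and [Psi] vanishes at zero, so the lifted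
sequence [z] is zero except at those times, where it is a column of [Lambda].
The active times are L apart, hence a window of length L meets at most one of
them; for every block position i and every pulse j, the window that starts at
j L + (L - 1 - i), with j counted from 0, has pulse j as its only nonzero block,
at position i.

Let a row vector [v], cut into L blocks v_i, annihilate the Hankel matrix.
Its product with the window above is v_i Psi(lambda_j), so v_i annihilates
every column of [Lambda], and v_i = 0 because [Lambda] is invertible.  Hence the
rows of the Hankel matrix, r L in number, are independent
([hankel_spaced_row_free]).  The length condition N >= (r + 1) L - 1 is what
makes the last window needed, the one starting at r L - 1, fit. *)

(** Blockwise form of a linear relation between the rows of a Hankel matrix:
it pairs the blocks of [v] with L consecutive terms of the sequence. *)
Lemma mulmx_hankel (R : realType) (eta N L : nat) (z : nat -> 'cV[R]_eta)
    (v : 'rV[R]_(\sum_(i < L) eta)) (t : 'I_(N - L + 1)) :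
  (v *m hankel N L z) 0 t = \sum_(i < L) (submxrow v i *m z (t + i)%N) 0 0.
Proof.
have -> : (v *m hankel N L z) 0 t = (v *m window L z t) 0 0.
  by rewrite !mxE; apply: eq_bigr => s _; rewrite !mxE.
by rewrite -{1}[v]submxrowK /window mul_mxrow_mxcol summxE.
Qed.

Lemma mulmx_of_cols_eq0 (R : realType) (n p : nat) (c : 'I_p -> 'cV[R]_n)
    (w : 'rV[R]_n) :
  (forall j, (w *m c j) 0 0 = 0) -> w *m mx_of_cols c = 0.
Proof.
move=> wc0; apply/rowP => j; rewrite [RHS]mxE -[RHS](wc0 j) !mxE.
by apply: eq_bigr => s _; rewrite !mxE.
Qed.

(** Pulses placed L apart are seen one at a time by windows of length L, so the
Hankel matrix inherits independence of its rows from the matrix of pulses; the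
number [r] of pulses may exceed their dimension [eta]. *)
Lemma hankel_spaced_row_free (R : realType) (eta N L r : nat)
    (z : nat -> 'cV[R]_eta) (c : 'I_r -> 'cV[R]_eta) :
  (L <= N)%N -> ((r + 1) * L - 1 <= N)%N ->
  (forall j : 'I_r, (j.+1 * L - 1 < N)%N -> z (j.+1 * L - 1)%N = c j) ->
  (forall k, (k < N)%N -> (forall j : 'I_r, k <> (j.+1 * L - 1)%N) ->
    z k = 0) ->
  row_free (mx_of_cols c) -> row_free (hankel N L z).
Proof.
move=> leLN leN z_pulse z_zero c_free; apply: inj_row_free => v vH0.
suff v_blk0 (i : 'I_L) : submxrow v i = 0.
  rewrite -[v]submxrowK; apply/rowP => s.
  by rewrite [RHS]mxE mxE v_blk0 mxE.
apply: (row_free_inj c_free); rewrite mul0mx.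
apply: mulmx_of_cols_eq0 => j.
have lt_iL := ltn_ord i.
have le_jL : (j.+1 * L <= r * L)%N by rewrite leq_mul2r ltn_ord orbT.
rewrite mulnDl mul1n in leN; rewrite mulSn in le_jL.
(* The unique window showing pulse [j] at block position [i]. *)
have lt_t : (j * L + (L - 1 - i) < N - L + 1)%N by lia.
have := mulmx_hankel z v (Ordinal lt_t).
rewrite vH0 mxE => /esym; rewrite (bigD1 i) //= big1 => [|i' ne_i'i].
  have -> : (j * L + (L - 1 - i) + i = j.+1 * L - 1)%N by rewrite mulSn; lia.
  by rewrite addr0 z_pulse // mulSn; lia.
have lt_i'L := ltn_ord i'.
rewrite z_zero ?mulmx0 ?mxE //; first lia.
move=> j' eq_times.
(* Block [i'] is shown at a time less than L away from the time of pulse [j],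
   so it can only coincide with that pulse, which would force [i' = i]. *)
have ne_val : (i' : nat) <> i by move=> e; case/eqP: ne_i'i; apply: val_inj.
rewrite mulSn in eq_times.
have [lt_jj'|lt_j'j|eq_jj'] := ltngtP j j'.
- have : (j.+1 * L <= j' * L)%N by rewrite leq_mul2r lt_jj' orbT.
  by rewrite mulSn; lia.
- have : (j'.+1 * L <= j * L)%N by rewrite leq_mul2r lt_j'j orbT.
  by rewrite mulSn; lia.
- by rewrite eq_jj' in eq_times; lia.
Qed.

(* The index j of psi, lam is 0-based: j : 'I_r stands for j+1 in {1, ..., r}. *)
Theorem theorem3 (R : realType) (L m r : nat)
    (hL : (0 < L)%N) (hm : (0 < m)%N) (hr : (0 < r)%N)
    (psi : 'I_r -> 'cV[R]_m -> R)
    (hpsi : lin_indep_funs psi)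
    (hpsi0 : forall j : 'I_r, psi j 0 = 0)
    (N : nat) (hN0 : (0 < N)%N) (hN : ((r + 1) * L - 1 <= N)%N)
    (lam : 'I_r -> 'cV[R]_m)
    (u : nat -> 'cV[R]_m)
    (hu_lam : forall (k : nat) (j : 'I_r),
        (k < N)%N -> k = (j.+1 * L - 1)%N -> u k = lam j)
    (hu_0 : forall k : nat,
        (k < N)%N -> (forall j : 'I_r, k <> (j.+1 * L - 1)%N) -> u k = 0) :
  let Psi := fun w : 'cV[R]_m => \col_(j < r) psi j w in
  let hatPsi := fun k : nat => Psi (u k) in
  let Lambda := mx_of_cols (fun j : 'I_r => Psi (lam j)) in
  Lambda \in unitmx ->
  \rank (hankel N L hatPsi) = (r * L)%N.
Proof.
move=> Psi hatPsi Lambda Lambda_unit.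
have Psi0 : Psi 0 = 0 by apply/colP => j; rewrite !mxE.
have leLN : (L <= N)%N.
  have : (1 * L <= r * L)%N by rewrite leq_mul2r hr orbT.
  by rewrite mulnDl mul1n in hN; lia.
have H_free : row_free (hankel N L hatPsi).
  apply: (hankel_spaced_row_free leLN hN (c := fun j => Psi (lam j))).
  - by move=> j lt_N; rewrite /hatPsi (hu_lam _ j).
  - by move=> k lt_N not_pulse; rewrite /hatPsi hu_0.
  - by rewrite row_free_unit.
by rewrite (eqP H_free) sum_nat_const card_ord mulnC.
Qed.
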